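(* Let $\alpha\in(-1,1)$ and let $a$ be the weight parameter. Define $\eta_k=0$ if $k<0$, $\eta_0=Y_0=\frac{\sqrt2}{2}$, and $\eta_k=\frac12$ otherwise. Then for $0\le k\le n$, with $i\in\{0,1\}$ if $k\ge 1$ and $i=0$ if $k=0$, the polynomials $Q^{(a)}_{n,k,i}(x,y,z)$ satisfy the following recurrences for $(x,y,z)\in\Omega$: \begin{align*} x\,Q^{(a)}_{n,k,i} &= \alpha^{(a)}_{n,k,1}Q^{(a)}_{n-1,k-1,i}+\alpha^{(a)}_{n,k,2}Q^{(a)}_{n-1,k+1,i}+\alpha^{(a)}_{n,k,3}Q^{(a)}_{n,k-1,i}\\ &\quad+\alpha^{(a)}_{n,k,4}Q^{(a)}_{n,k+1,i}+\alpha^{(a)}_{n,k,5}Q^{(a)}_{n+1,k-1,i}+\alpha^{(a)}_{n,k,6}Q^{(a)}_{n+1,k+1,i},\\ y\,Q^{(a)}_{n,k,i} &= \beta^{(a)}_{n,k,i,1}Q^{(a)}_{n-1,k-1,|i-1|}+\beta^{(a)}_{n,k,i,2}Q^{(a)}_{n-1,k+1,|i-1|}+\beta^{(a)}_{n,k,i,3}Q^{(a)}_{n,k-1,|i-1|}\\ &\quad+\beta^{(a)}_{n,k,i,4}Q^{(a)}_{n,k+1,|i-1|}+\beta^{(a)}_{n,k,i,5}Q^{(a)}_{n+1,k-1,|i-1|}+\beta^{(a)}_{n,k,i,6}Q^{(a)}_{n+1,k+1,|i-1|},\\ z\,Q^{(a)}_{n,k,i} &= \gamma^{(a)}_{n,k,1}Q^{(a)}_{n-1,k,i}+\gamma^{(a)}_{n,k,2}Q^{(a)}_{n,k,i}+\gamma^{(a)}_{n,k,3}Q^{(a)}_{n+1,k,i},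 \end{align*} where \begin{align*} \alpha^{(a)}_{n,k,1}&=\eta_{k-1}\,\big\langle R^{(a,2k)}_{n-k},R^{(a,2(k-1))}_{n-k}\big\rangle_{w_R^{(a,2k)}}, & \alpha^{(a)}_{n,k,2}&=\eta_k\,\big\langle R^{(a,2k)}_{n-k},R^{(a,2(k+1))}_{n-k-2}\big\rangle_{w_R^{(a,2(k+1))}},\\ \alpha^{(a)}_{n,k,3}&=\eta_{k-1}\,\big\langle R^{(a,2k)}_{n-k},R^{(a,2(k-1))}_{n-k+1}\big\rangle_{w_R^{(a,2k)}}, & \alpha^{(a)}_{n,k,4}&=\eta_k\,\big\langle R^{(a,2k)}_{n-k},R^{(a,2(k+1))}_{n-k-1}\big\rangle_{w_R^{(a,2(k+1))}},\\ \alpha^{(a)}_{n,k,5}&=\eta_{k-1}\,\big\langle R^{(a,2k)}_{n-k},R^{(a,2(k-1))}_{n-k+2}\big\rangle_{w_R^{(a,2k)}}, & \alpha^{(a)}_{n,k,6}&=\eta_k\,\big\langle R^{(a,2k)}_{n-k},R^{(a,2(k+1))}_{n-k}\big\rangle_{w_R^{(a,2(k+1))}}, \end{align*} $\beta^{(a)}_{n,k,i,j}=-\alpha^{(a)}_{n,k,j}$ if ($i=0$ and $j$ is odd) or ($i=1$ and $j$ is even), and $\beta^{(a)}_{n,k,i,j}=\alpha^{(a)}_{n,k,j}$ otherwise; and $$\gamma^{(a)}_{n,k,1}=\beta^{(a,2k)}_{n-k-1},\qquad \gamma^{(a)}_{n,k,2}=\alpha^{(a,2k)}_{n-k},\qquad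 \gamma^{(a)}_{n,k,3}=\beta^{(a,2k)}_{n-k}.$$
   Context: **Domain.** $\Omega=\{(x,y,z)\in\mathbb{R}^3:\alpha<z<1,\ x^2+y^2+z^2=1\}$, $\rho(z)=\sqrt{1-z^2}$, and $\theta$ is defined by $x=\rho(z)\cos\theta$, $y=\rho(z)\sin\theta$. **Univariate polynomials.** For parameters $a,b$ let $w_R^{(a,b)}(z)=(z-\alpha)^a\rho(z)^b$ on $(\alpha,1)$, $\omega_R^{(a,b)}=\int_\alpha^1 w_R^{(a,b)}(z)\,dz$, and $\langle p,q\rangle_{w_R^{(a,b)}}=\frac1{\omega_R^{(a,b)}}\int_\alpha^1p\,q\,w_R^{(a,b)}\,dz$. $R^{(a,b)}_n$ ($n\ge0$) denotes the polynomials of degree $n$ orthonormal for $\langle\cdot,\cdot\rangle_{w_R^{(a,b)}}$, and $R^{(a,b)}_n:=0$ for $n<0$. The numbers $\alpha_n^{(a,b)},\beta_n^{(a,b)}$ are their three-term recurrence coefficients: $$x R^{(a,b)}_n(x)=\beta_n^{(a,b)}R^{(a,b)}_{n+1}(x)+\alpha_n^{(a,b)}R^{(a,b)}_n(x)+\beta_{n-1}^{(a,b)}R^{(a,b)}_{n-1}(x),$$ with $\beta_{-1}^{(a,b)}:=0$. **Polynomials on the cap.** $Y_{0,0}(\theta)=Y_0=\frac{\sqrt2}2$, and $Y_{k,0}(\theta)=\cos k\theta$, $Y_{k,1}(\theta)=\sin k\theta$ for $k\ge1$. For $0\le k\le n$ (with $i\in\{0,1\}$ if $k\ge1$, $i=0$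 if $k=0$), $Q^{(a)}_{n,k,i}(x,y,z)=R^{(a,2k)}_{n-k}(z)\,\rho(z)^k\,Y_{k,i}(\theta)$. These are orthogonal with respect to $\int_\Omega p\,q\,(z-\alpha)^a\,dA$, where $dA$ is the uniform spherical measure. Any $Q^{(a)}_{m,j,h}$ whose indices are outside this range ($j<0$, $j>m$, or $j=0$ and $h=1$) is interpreted as $0$; for $k=0$ the coefficients containing the factor $\eta_{-1}=0$ are $0$.
   Formalization: The coefficients α_{n,k,j} for j=1,3,5 (hence the corresponding β_{n,k,i,j}) carry the extra factor ω_R^{(a,2k)}/ω_R^{(a,2(k-1))}; with the normalised inner product the printed formulas fail, e.g. for n=k=1, i=0. *)

(* Defs.v *)
From HB Require Import structures.
From mathcomp Require Import all_boot all_order all_algebra.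
From mathcomp Require Import all_classical all_reals all_analysis.

Set Implicit Arguments.
Unset Strict Implicit.
Unset Printing Implicit Defensive.

Import Order.TTheory GRing.Theory Num.Theory.
Import numFieldNormedType.Exports.

Local Open Scope classical_set_scope.
Local Open Scope ring_scope.

(* All indices n, k, i are integers, so that shifted indices such as k - 1 or
   n - k - 2 are the true differences. *)

Definition cap (R : realType) (alpha : R) : set (R * R * R) :=
  [set u | let: (x, y, z) := u in
     alpha < z < 1 /\ x ^+ 2 + y ^+ 2 + z ^+ 2 = 1].

Definition rho (R : realType) (z : R) : R := Num.sqrt (1 - z ^+ 2).

(* Determined only modulo 2 pi, which is immaterial for Y below. *)
Definition theta (R : realType) (x y z : R) : R :=
  xget 0 [set t | x = rho z * cos t /\ y = rho z * sin t].

Definition wR (R : realType) (alpha a b z : R) : R :=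
  (z - alpha) `^ a * rho z `^ b.

Definition omegaR (R : realType) (alpha a b : R) : R :=
  \int[lebesgue_measure]_(z in `]alpha, 1[) wR alpha a b z.

Definition ipR (R : realType) (alpha a b : R) (p q : {poly R}) : R :=
  (omegaR alpha a b)^-1 *
  \int[lebesgue_measure]_(z in `]alpha, 1[) (p.[z] * q.[z] * wR alpha a b z).

(* Signs of the leading coefficients are left free. *)
Definition orthonormal_polys (R : realType) (alpha a b : R)
    (p : nat -> {poly R}) : Prop :=
  (forall n, size (p n) = n.+1) /\
  (forall m n, ipR alpha a b (p m) (p n) = (m == n)%:R).

Definition polyz (R : realType) (p : nat -> {poly R}) (n : int) : {poly R} :=
  match n with Posz m => p m | Negz _ => 0 end.

(* c = (alpha_n, beta_n); uniquely determined by p for n >= 0 when p is an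
   orthonormal family. *)
Definition three_term (R : realType) (p : nat -> {poly R})
    (c : (int -> R) * (int -> R)) : Prop :=
  c.2 (-1) = 0 /\
  forall n : int, 0 <= n ->
    'X * polyz p n = c.2 n *: polyz p (n + 1) + c.1 n *: polyz p n
                     + c.2 (n - 1) *: polyz p (n - 1).

Definition rec_coefs (R : realType) (p : nat -> {poly R}) :
    (int -> R) * (int -> R) :=
  xget (fun=> 0, fun=> 0) [set c | three_term p c].

Definition alphaR (R : realType) (p : nat -> {poly R}) (n : int) : R :=
  (rec_coefs p).1 n.

Definition betaR (R : realType) (p : nat -> {poly R}) (n : int) : R :=
  (rec_coefs p).2 n.

Definition Y (R : realType) (k i : int) (t : R) : R :=
  if k == 0 then Num.sqrt 2 / 2
  else if i == 0 then cos (k%:~R * t) else sin (k%:~R * t).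

Definition admissible (n k i : int) : bool :=
  (0 <= k <= n) && ((i == 0) || ((i == 1) && (1 <= k))).

(* In the sequel P b n stands for the degree n polynomial of the family
   orthonormal for the weight wR alpha a b, with a fixed. *)
Definition Q (R : realType) (P : R -> nat -> {poly R}) (n k i : int)
    (x y z : R) : R :=
  if admissible n k i then
    (polyz (P (2 * k)%:~R) (n - k)).[z] * rho z ^ k * Y k i (theta x y z)
  else 0.

Definition eta (R : realType) (k : int) : R :=
  if k < 0 then 0 else if k == 0 then Num.sqrt 2 / 2 else 2^-1.

(* For odd j one expands rho^2 R_(n-k)^(a,2k) in the R_m^(a,2(k-1)). Since
   rho^2 w^(a,2(k-1)) = w^(a,2k) while each inner product is normalised by the
   mass of its own weight, the coefficient in the expansion is the inner
   product for w^(a,2k) times the ratio of the two masses. *)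
Definition alphaQ (R : realType) (alpha a : R) (P : R -> nat -> {poly R})
    (n k : int) (j : nat) : R :=
  let bk : R := (2 * k)%:~R in
  let bm : R := (2 * (k - 1))%:~R in
  let bp : R := (2 * (k + 1))%:~R in
  let down m := eta R (k - 1) * (omegaR alpha a bk / omegaR alpha a bm) *
    ipR alpha a bk (polyz (P bk) (n - k)) (polyz (P bm) m) in
  let up m := eta R k *
    ipR alpha a bp (polyz (P bk) (n - k)) (polyz (P bp) m) in
  match j with
  | 1 => down (n - k)
  | 2 => up (n - k - 2)
  | 3 => down (n - k + 1)
  | 4 => up (n - k - 1)
  | 5 => down (n - k + 2)
  | 6 => up (n - k)
  | _ => 0
  end.

Definition betaQ (R : realType) (alpha a : R) (P : R -> nat -> {poly R})
    (n k i : int) (j : nat) : R :=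
  if ((i == 0) && odd j) || ((i == 1) && ~~ odd j)
  then - alphaQ alpha a P n k j else alphaQ alpha a P n k j.

Definition gammaQ (R : realType) (P : R -> nat -> {poly R})
    (n k : int) (j : nat) : R :=
  match j with
  | 1 => betaR (P (2 * k)%:~R) (n - k - 1)
  | 2 => alphaR (P (2 * k)%:~R) (n - k)
  | 3 => betaR (P (2 * k)%:~R) (n - k)
  | _ => 0
  end.

(* Main.v *)
(* Multiplying by x = rho cos theta or y = rho sin theta shifts the angular
   frequency k by one, by the addition formulas, and raises the power of rho to
   k + 1. For frequency k + 1 one expands R_N^(a,2k) in the R_j^(a,2k+2); for
   frequency k - 1 one expands rho^2 R_N^(a,2k) in the R_j^(a,2k-2). As
   w^(a,b+2) = rho^2 w^(a,b), both expansions, like the one of z R_N in the R_j,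
   have only three terms: all lower coefficients are inner products of an
   orthonormal polynomial with a polynomial of smaller degree. *)
Require Import Defs.
From HB Require Import structures.
From mathcomp Require Import all_boot all_order all_algebra.
From mathcomp Require Import all_classical all_reals all_analysis.
From mathcomp Require Import measurable_realfun ring lra zify.
Import Order.TTheory GRing.Theory Num.Theory.
Import numFieldNormedType.Exports.
Local Open Scope classical_set_scope.
Local Open Scope ring_scope.

Set Implicit Arguments.
Unset Strict Implicit.

(** * Integrals of polynomials against the weight, and the inner product *)

Lemma bounded_horner (R : realType) (D : set R) (p : {poly R}) :
  (forall z, D z -> `|z| <= 1) -> [bounded p.[z] | z in D].
Proof.
move=> D1; exists (\sum_(i < size p) `|p`_i|); split; first exact: num_real.
move=> M ltM z Dz; apply: le_trans (ltW ltM); rewrite horner_coef.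
apply: le_trans (ler_norm_sum _ _ _) (ler_sum _ _) => i _.
by rewrite normrM normrX ler_piMr// exprn_ile1// D1.
Qed.

Lemma measurable_wR (R : realType) (alpha a b : R) (D : set R) :
  measurable_fun D (wR alpha a b).
Proof.
apply: measurable_funS measurableT _ _ => //; apply: measurable_funM.
  apply: (@measurableT_comp _ _ _ _ _ _ ((@powR R)^~ a)) => //.
  exact: measurable_funB.
apply: (@measurableT_comp _ _ _ _ _ _ ((@powR R)^~ b)) => //.
apply: (@measurableT_comp _ _ _ _ _ _ (@Num.sqrt R)).
  by apply: continuous_measurable_fun => t; exact: sqrt_continuous.
by apply: measurable_funB => //; exact: measurable_funX.
Qed.

Lemma wR_ge0 (R : realType) (alpha a b z : R) : 0 <= wR alpha a b z.
Proof. by rewrite mulr_ge0 ?powR_ge0. Qed.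

(* If the mass were infinite, the real-valued integral would take the junk value
   0. *)
Lemma integrable_wR (R : realType) (alpha a b : R) :
  omegaR alpha a b != 0 ->
  lebesgue_measure.-integrable `]alpha, 1[ (EFin \o wR alpha a b).
Proof.
rewrite /omegaR /Rintegral => w0; apply/integrableP; split.
  by apply/measurable_EFinP; exact: measurable_wR.
under eq_integral => z _ do rewrite /= ger0_norm ?wR_ge0//.
by move: w0; case: integral => [r _||] /=; rewrite ?ltry ?eqxx.
Qed.

(** Since [-1 < alpha], the interval lies in [-1, 1], so a polynomial is a bounded factor of an
    integrable weight. This is what makes [ipR] additive. *)
Lemma integrable_horner_wR (R : realType) (alpha a b : R) (p : {poly R}) :
  -1 < alpha -> omegaR alpha a b != 0 ->
  lebesgue_measure.-integrable `]alpha, 1[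
    (EFin \o (fun z => p.[z] * wR alpha a b z)).
Proof.
move=> alpha1 w0; rewrite (_ : _ \o _ =
  ((EFin \o wR alpha a b) \* (EFin \o horner p))%E); last first.
  by apply/funext => z /=; rewrite mulrC EFinM.
apply: integrableMl => //; first exact: integrable_wR.
  exact: measurable_poly.
apply: bounded_horner => z /=; rewrite in_itv/= => /andP[z1 z2].
by rewrite ler_norml (ltW z2) (ltW (lt_trans alpha1 z1)).
Qed.

Lemma ipRC (R : realType) (alpha a b : R) (p q : {poly R}) :
  ipR alpha a b p q = ipR alpha a b q p.
Proof. by rewrite /ipR; under eq_Rintegral do rewrite [_ * q.[_]]mulrC. Qed.

(** Self-adjointness of multiplication: for [r] equal to ['X] or [1 - 'X^2], the factor moves onto
    the argument of smaller degree. *)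
Lemma ipR_mull (R : realType) (alpha a b : R) (r p q : {poly R}) :
  ipR alpha a b (r * p) q = ipR alpha a b p (r * q).
Proof.
rewrite /ipR; congr (_ * _); apply: eq_Rintegral => z _.
by rewrite !hornerM; ring.
Qed.

Lemma ipR_linear (R : realType) (alpha a b : R) (r p q : {poly R}) (c : R) :
  -1 < alpha -> omegaR alpha a b != 0 ->
  ipR alpha a b (c *: p + q) r = c * ipR alpha a b p r + ipR alpha a b q r.
Proof.
move=> alpha1 w0; rewrite /ipR.
have int s := integrable_horner_wR s alpha1 w0.
under eq_Rintegral do rewrite -hornerM mulrDl hornerD -scalerAl hornerZ mulrDl
  -mulrA.
rewrite RintegralD ?RintegralZl ?mulrDr//=; last first.
  apply: eq_integrable (int (c *: (p * r))) => // z _.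
  by rewrite /= hornerZ mulrA.
rewrite mulrCA; congr (_ * (_ * _) + _ * _).
  by under eq_Rintegral do rewrite hornerM.
by under eq_Rintegral do rewrite hornerM.
Qed.

Lemma wRD2 (R : realType) (alpha a b z : R) : -1 < z < 1 ->
  wR alpha a (b + 2) z = (1 - z ^+ 2) * wR alpha a b z.
Proof.
move=> /andP[z1 z2]; have z0 : 0 < 1 - z ^+ 2 by nra.
(* The exponent law for real powers can fail only at base 0, and [rho z] is positive here. *)
rewrite /wR powRD; last by rewrite [rho z == 0]gt_eqF ?implybT ?sqrtr_gt0.
by rewrite powR_mulrn ?sqrtr_ge0// /rho sqr_sqrtr ?ltW//; ring.
Qed.

Lemma omega_ipRD2 (R : realType) (alpha a b : R) (p q : {poly R}) :
  -1 < alpha -> omegaR alpha a b != 0 -> omegaR alpha a (b + 2) != 0 ->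
  ipR alpha a b ((1 - 'X^2) * p) q =
  omegaR alpha a (b + 2) / omegaR alpha a b * ipR alpha a (b + 2) p q.
Proof.
move=> alpha1 w0 w2; rewrite /ipR.
transitivity ((omegaR alpha a b)^-1 * \int[lebesgue_measure]_(z in `]alpha, 1[)
    (p.[z] * q.[z] * wR alpha a (b + 2) z)); last by field; rewrite w0 w2.
congr (_ * _); apply: eq_Rintegral => z; rewrite inE/= in_itv/= => /andP[z1 z2].
rewrite wRD2 ?(lt_trans alpha1 z1)// !hornerM.
by have -> : (1 - 'X^2).[z] = 1 - z ^+ 2 by [rewrite !hornerE]; ring.
Qed.

(* Otherwise the inverse of the mass would be 0, and so all inner products. *)
Lemma orthonormal_omega_neq0 (R : realType) (alpha a b : R)
    (p : nat -> {poly R}) :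
  orthonormal_polys alpha a b p -> omegaR alpha a b != 0.
Proof.
case=> _ /(_ 0 0)%N; rewrite /ipR eqxx; apply: contra_eqN => /eqP ->.
by rewrite invr0 mul0r eq_sym oner_eq0.
Qed.

Lemma ipR0l (R : realType) (alpha a b : R) (p : {poly R}) :
  ipR alpha a b 0 p = 0.
Proof.
rewrite /ipR; under eq_Rintegral do rewrite horner0 !mul0r.
by rewrite Rintegral_cst ?mul0r ?mulr0.
Qed.

(** * Expansion in an orthonormal family *)

Lemma ipR_sum (R : realType) (alpha a b : R) (r : {poly R}) n
    (c : nat -> R) (p : nat -> {poly R}) :
  -1 < alpha -> omegaR alpha a b != 0 ->
  ipR alpha a b (\sum_(j < n) c j *: p j) r =
  \sum_(j < n) c j * ipR alpha a b (p j) r.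
Proof.
move=> alpha1 w0; elim: n => [|n IHn]; last first.
  by rewrite !big_ord_recr/= addrC ipR_linear// IHn addrC.
by rewrite !big_ord0 ipR0l.
Qed.

(** Induction on the degree: a multiple of [p n], whose leading coefficient is nonzero, cancels the
    coefficient of degree [n] in [f]. *)
Lemma size_poly_spanning (R : fieldType) (p : nat -> {poly R}) n (f : {poly R}) :
  (forall m, size (p m) = m.+1) -> (size f <= n)%N ->
  exists c : nat -> R, f = \sum_(j < n) c j *: p j.
Proof.
move=> size_p; elim: n f => [|n IHn] f sf.
  by exists (fun=> 0); rewrite big_ord0; apply/eqP; rewrite -size_poly_leq0.
have pn0 : (p n)`_n != 0.
  by rewrite -[n in _`_n]/(n.+1.-1) -(size_p n) lead_coef_eq0 -size_poly_eq0 size_p.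
have [|c Ec] := IHn (f - (f`_n / (p n)`_n) *: p n).
  apply/leq_sizeP => j; rewrite leq_eqVlt => /orP[/eqP<-|nj].
    by rewrite coefB coefZ mulfVK// subrr.
  rewrite coefB coefZ [f`_j]nth_default ?(leq_trans sf)//.
  by rewrite [(p n)`_j]nth_default ?size_p// mulr0 subrr.
exists (fun j => if j == n then f`_n / (p n)`_n else c j).
rewrite big_ord_recr/= eqxx -[LHS](subrK ((f`_n / (p n)`_n) *: p n)) Ec.
by congr (_ + _); apply: eq_bigr => j _; rewrite ltn_eqF.
Qed.

Lemma orthonormal_expansion (R : realType) (alpha a b : R)
    (p : nat -> {poly R}) n (f : {poly R}) :
  -1 < alpha -> orthonormal_polys alpha a b p -> (size f <= n)%N ->
  f = \sum_(j < n) ipR alpha a b f (p j) *: p j.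
Proof.
move=> alpha1 hp sf; have [c ->] := size_poly_spanning hp.1 sf.
apply: eq_bigr => j _; congr (_ *: _).
rewrite ipR_sum ?(orthonormal_omega_neq0 hp)// (bigD1 j)//= hp.2 eqxx mulr1.
by rewrite big1 ?addr0// => l; rewrite -val_eqE hp.2/= => /negbTE->; rewrite mulr0.
Qed.

Lemma orthonormal_ortho (R : realType) (alpha a b : R)
    (p : nat -> {poly R}) n (f : {poly R}) :
  -1 < alpha -> orthonormal_polys alpha a b p -> (size f <= n)%N ->
  ipR alpha a b (p n) f = 0.
Proof.
move=> alpha1 hp sf; rewrite (orthonormal_expansion alpha1 hp sf).
rewrite ipRC (ipR_sum _ _ (fun j => ipR alpha a b f (p j)) p)
  ?(orthonormal_omega_neq0 hp)//.
by rewrite big1// => j _; rewrite hp.2 ltn_eqF ?mulr0.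
Qed.

Lemma band_expansion (R : realType) (alpha a b : R)
    (p : nat -> {poly R}) n (f : {poly R}) :
  -1 < alpha -> orthonormal_polys alpha a b p -> (size f <= n.+1)%N ->
  (forall m : nat, (m.+2 < n)%N -> ipR alpha a b f (p m) = 0) ->
  let c (j : int) := ipR alpha a b f (polyz p j) *: polyz p j in
  f = c n%:Z + c (n%:Z - 1) + c (n%:Z - 2).
Proof.
move=> alpha1 hp sf f0 c.
rewrite [LHS](orthonormal_expansion alpha1 hp sf).
have c0 (j : int) : j < 0 -> c j = 0 by case: j => // j _; rewrite /c scaler0.
have cE m : ipR alpha a b f (p m) *: p m = c m%:Z by [].
(* For [n] equal to 0 or 1 the sum has fewer than three terms; the missing ones have negative index
   and vanish by [c0]. *)
case: n sf f0 => [|[|n]] _ f0; rewrite !big_ord_recr/= !cE.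
- by rewrite big_ord0 add0r [c (_ - 1)]c0// [c (_ - 2)]c0// !addr0.
- by rewrite big_ord0 add0r subrr [c (_ - 2)]c0// addr0 addrC.
rewrite big1 => [|j _]; last by rewrite f0 ?scale0r//= !ltnS.
rewrite add0r [c n + _]addrC addrC addrA.
by congr (c _ + c _ + c _); lia.
Qed.

Lemma size_polyXM (R : realType) (p : {poly R}) n :
  (size p <= n)%N -> (size ('X * p)%R <= n.+1)%N.
Proof.
move=> sp; rewrite (leq_trans (size_polyMleq _ _))// size_polyX /=.
by rewrite -ltnS (leq_trans _ (_ : n.+1 < n.+2)%N)//.
Qed.

(** [rec_coefs] is a choice, so one valid pair has to be exhibited: the Fourier coefficients of
    ['X * p n] along [p n] and [p (n + 1)]. *)
Lemma rec_coefsP (R : realType) (alpha a b : R) (p : nat -> {poly R}) :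
  -1 < alpha -> orthonormal_polys alpha a b p -> three_term p (rec_coefs p).
Proof.
move=> alpha1 hp; rewrite /rec_coefs; case: xgetP => [c -> //|/(_ (
  fun j => ipR alpha a b ('X * polyz p j) (polyz p j),
  fun j => ipR alpha a b ('X * polyz p j) (polyz p (j + 1)))) []].
split=> /= [|n n0].
  have -> : 'X * polyz p (-1) = 0 by exact: mulr0.
  by rewrite ipR0l.
case: n n0 => // n _.
(* Symmetry of the recurrence: by self-adjointness the coefficient going down from [n] is the one
   going up from [n - 1], so one sequence serves both. *)
have -> : ipR alpha a b ('X * polyz p (Posz n - 1)) (polyz p (Posz n - 1 + 1)) =
    ipR alpha a b ('X * p n) (polyz p (Posz n - 1)).
  by rewrite ipR_mull ipRC subrK.
have sX : (size ('X * p n)%R <= n.+2)%N by rewrite size_polyXM ?hp.1.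
have := band_expansion alpha1 hp sX; rewrite -addn1 PoszD.
rewrite addrK -[_ + 1 - 2]addrA; apply => m mn.
rewrite ipR_mull (orthonormal_ortho alpha1 hp)//; move: mn; rewrite addn1 ltnS; apply: leq_trans.
by rewrite size_polyXM ?hp.1.
Qed.


(** * The polar angle on the cap *)

Lemma theta_polar (R : realType) (alpha x y z : R) : -1 < alpha ->
  cap alpha (x, y, z) ->
  x = rho z * cos (theta x y z) /\ y = rho z * sin (theta x y z).
Proof.
(* The default value of [xget] is excluded by producing an angle: [acos (x / rho z)] or its
   opposite, according to the sign of [y]. The sine of an arccosine is nonnegative and so yields
   only the absolute value of [y]. *)
move=> alpha1 [/andP[z1 z2] xyz]; rewrite /theta; case: xgetP => [t _ //|nex].
have r0 : 0 < rho z by rewrite sqrtr_gt0; nra.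
have r2 : rho z ^+ 2 = x ^+ 2 + y ^+ 2.
  by rewrite sqr_sqrtr; [lra | nra].
have x1 : -1 <= x / rho z <= 1.
  rewrite ler_pdivlMr// ler_pdivrMr// mulN1r mul1r -ler_norml.
  by rewrite -(ler_sqr) ?nnegrE// ?(ltW r0)// real_normK ?num_real// r2 lerDl sqr_ge0.
have sinE : rho z * sin (acos (x / rho z)) = `|y|.
  rewrite sin_acos// -[in RHS]sqrtr_sqr.
  have -> : y ^+ 2 = rho z ^+ 2 * (1 - (x / rho z) ^+ 2).
    have -> : y ^+ 2 = rho z ^+ 2 - x ^+ 2 by rewrite r2; ring.
    by field; rewrite gt_eqF.
  by rewrite sqrtrM ?sqr_ge0// sqrtr_sqr gtr0_norm.
have xE : x = rho z * cos (acos (x / rho z)).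
  by rewrite acosK ?in_itv// mulrC mulfVK ?gt_eqF.
have [y0|y0] := leP 0 y.
  have [] := nex (acos (x / rho z)); split => //.
  by rewrite sinE ger0_norm.
have [] := nex (- acos (x / rho z)); split; first by rewrite cosN.
by rewrite sinN mulrN sinE ltr0_norm ?opprK.
Qed.

(** * Passing between the families of parameters b and b + 2 *)

Lemma size_poly_1BX2M (R : realType) (p : {poly R}) n :
  (size p <= n)%N -> (size ((1 - 'X^2) * p)%R <= n.+2)%N.
Proof.
move=> sp; rewrite mulrBl mul1r (leq_trans (size_polyD _ _))// geq_max size_polyN.
by rewrite exprS expr1 -mulrA !size_polyXM// (leq_trans sp) ?leqW.
Qed.

(** Up to a nonzero ratio of masses, the coefficient along [q m] is the inner product for [b] of
    [p n] with [(1 - 'X^2) * q m], which has degree m + 2; it vanishes once m + 2 < n. *)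
Lemma raise_expansion (R : realType) (alpha a b : R) (p q : nat -> {poly R})
    (n : nat) :
  -1 < alpha -> orthonormal_polys alpha a b p ->
  orthonormal_polys alpha a (b + 2) q ->
  let c (j : int) := ipR alpha a (b + 2) (p n) (polyz q j) *: polyz q j in
  p n = c n%:Z + c (n%:Z - 1) + c (n%:Z - 2).
Proof.
move=> alpha1 hp hq; apply: band_expansion => //; first by rewrite hp.1.
have w0 := orthonormal_omega_neq0 hp; have w2 := orthonormal_omega_neq0 hq.
move=> m mn; have /eqP : ipR alpha a b ((1 - 'X^2) * p n) (q m) = 0.
  rewrite ipR_mull (orthonormal_ortho alpha1 hp)//; apply: leq_trans mn.
  by rewrite size_poly_1BX2M ?hq.1.
rewrite omega_ipRD2// mulf_eq0 mulf_eq0 invr_eq0 (negbTE w0) (negbTE w2).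
by move=> /eqP.
Qed.

(** The factor [1 - 'X^2] is absorbed by the weight, so the coefficient along [q m] is a multiple of
    the inner product for [b + 2] of [p n] with [q m]; it vanishes once m < n. *)
Lemma lower_expansion (R : realType) (alpha a b : R) (p q : nat -> {poly R})
    (n : nat) :
  -1 < alpha -> orthonormal_polys alpha a (b + 2) p ->
  orthonormal_polys alpha a b q ->
  let c (j : int) := (omegaR alpha a (b + 2) / omegaR alpha a b *
    ipR alpha a (b + 2) (p n) (polyz q j)) *: polyz q j in
  (1 - 'X^2) * p n = c (n%:Z + 2) + c (n%:Z + 1) + c n%:Z.
Proof.
move=> alpha1 hp hq c.
have w0 := orthonormal_omega_neq0 hq; have w2 := orthonormal_omega_neq0 hp.
have sf : (size ((1 - 'X^2) * p n)%R <= n.+3)%N by rewrite size_poly_1BX2M ?hp.1.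
have := band_expansion alpha1 hq sf; cbv beta zeta; rewrite !omega_ipRD2//.
rewrite (_ : n.+2%:Z = n%:Z + 2); last by lia.
rewrite (_ : n%:Z + 2 - 1 = n%:Z + 1); last by lia.
rewrite addrK; apply => m mn; rewrite omega_ipRD2//.
rewrite (orthonormal_ortho alpha1 hp) ?mulr0// hq.1; lia.
Qed.

(** * Angular factors, extended by zero, and their products with cosine and sine *)

Definition Yext (R : realType) (k i : int) (t : R) : R :=
  if (0 <= k) && ((i == 0) || (i == 1) && (1 <= k)) then Y k i t else 0.

(** Removes the range test from [Q]: for k > n the factor [polyz] has negative index and is 0, and
    every other excluded case is a zero of [Yext]. *)
Lemma QE (R : realType) (P : R -> nat -> {poly R}) (n k i : int) (x y z : R) :
  Q P n k i x y z = (polyz (P (2 * k)%:~R) (n - k)).[z] * rho z ^ k *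
                    Yext k i (theta x y z).
Proof.
rewrite /Q /Yext /admissible.
have [k0|k0] := leP 0 k; last by rewrite mulr0.
have [kn|nk] /= := leP k n; first by case: ifP => _; rewrite ?mulr0.
suff -> : polyz (P (2 * k)%:~R) (n - k) = 0 by rewrite horner0 !mul0r.
have : n - k < 0 by lia.
by case: (n - k).
Qed.

Lemma Yext_cos (R : realType) (k : int) (t : R) :
  1 <= k -> Yext k 0 t = cos (k%:~R * t).
Proof.
move=> k1; have [k0 kn0] : 0 <= k /\ (k == 0) = false by lia.
by rewrite /Yext /Y k0 kn0.
Qed.

Lemma Yext_sin (R : realType) (k : int) (t : R) :
  1 <= k -> Yext k 1 t = sin (k%:~R * t).
Proof.
move=> k1; have [k0 kn0] : 0 <= k /\ (k == 0) = false by lia.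
by rewrite /Yext /Y k0 k1 kn0.
Qed.

(* The value of eta at 0 makes the normalisation of Y at k = 0 disappear. *)
Lemma etaM_Yext (R : realType) (k : int) (t : R) : 0 <= k ->
  Defs.eta R k * Yext k 0 t = 2^-1 * cos (k%:~R * t) /\
  Defs.eta R k * Yext k 1 t = 2^-1 * sin (k%:~R * t).
Proof.
move=> k0; have [->|kn0] := eqVneq k 0.
  rewrite !mul0r cos0 sin0 /Yext /Y /Defs.eta /= !mulr0 mulr1; split=> //.
  have : Num.sqrt 2 ^+ 2 = 2 :> R by rewrite sqr_sqrtr.
  by rewrite expr2 => E; rewrite mulf_div E; field.
have k1 : 1 <= k by lia.
by rewrite Yext_cos// Yext_sin// /Defs.eta ltNge k0 (negbTE kn0).
Qed.

Lemma eta_half (R : realType) (k : int) : 1 <= k -> Defs.eta R k = 2^-1.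
Proof.
move=> k1; have [k0 kn0] : 0 <= k /\ (k == 0) = false by lia.
by rewrite /Defs.eta ltNge k0 kn0.
Qed.

Lemma cosM_Yext (R : realType) (k i : int) (t : R) :
  0 <= k -> (i == 0) || (i == 1) && (1 <= k) ->
  cos t * Yext k i t =
    Defs.eta R (k - 1) * Yext (k - 1) i t + Defs.eta R k * Yext (k + 1) i t.
Proof.
move=> k0 ki; have [k_eq0|k1] := ltP k 1.
  have -> : k = 0 by lia.
  have -> : i = 0 by lia.
  by rewrite !add0r (@Yext_cos _ 1)// mul1r /Yext /Y /Defs.eta/= !mul0r add0r mulrC.
have k10 : 0 <= k - 1 by lia.
have k11 : 1 <= k + 1 by lia.
have [etac etas] := etaM_Yext t k10.
case/orP: ki => [/eqP->|/andP[/eqP-> _]].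
  rewrite etac !Yext_cos// eta_half// intrB intrD mulrBl mulrDl. rewrite !mul1r.
  by rewrite cosB cosD; field.
rewrite etas !Yext_sin// eta_half// intrB intrD mulrBl mulrDl !mul1r.
by rewrite sinB sinD; field.
Qed.

(** The source of the signs in [betaQ]: here the minus falls on frequency k - 1, that is on odd j,
    and in [sinM_Yext1] on frequency k + 1, that is on even j. *)
Lemma sinM_Yext0 (R : realType) (k : int) (t : R) :
  0 <= k ->
  sin t * Yext k 0 t =
    Defs.eta R k * Yext (k + 1) 1 t - Defs.eta R (k - 1) * Yext (k - 1) 1 t.
Proof.
move=> k0; have [k_eq0|k1] := ltP k 1.
  have -> : k = 0 by lia.
  by rewrite !add0r (@Yext_sin _ 1)// mul1r /Yext /Y /Defs.eta/= !mul0r subr0 mulrC.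
have k10 : 0 <= k - 1 by lia.
have k11 : 1 <= k + 1 by lia.
rewrite (etaM_Yext t k10).2 Yext_cos// Yext_sin// eta_half//.
by rewrite intrB intrD mulrBl mulrDl !mul1r sinB sinD; field.
Qed.

Lemma sinM_Yext1 (R : realType) (k : int) (t : R) :
  1 <= k ->
  sin t * Yext k 1 t =
    Defs.eta R (k - 1) * Yext (k - 1) 0 t - Defs.eta R k * Yext (k + 1) 0 t.
Proof.
move=> k1; have k10 : 0 <= k - 1 by lia.
have k11 : 1 <= k + 1 by lia.
rewrite (etaM_Yext t k10).1 Yext_cos// Yext_sin// eta_half//.
by rewrite intrB intrD mulrBl mulrDl !mul1r cosB cosD; field.
Qed.

(** * The factors depending on z, and assembly of the recurrences *)

Lemma alphaQ_down (R : realType) (alpha a : R) (P : R -> nat -> {poly R})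
    (n k : int) (z : R) :
  -1 < alpha -> alpha < z < 1 ->
  (forall k : int, 0 <= k ->
    orthonormal_polys alpha a (2 * k)%:~R (P (2 * k)%:~R)) ->
  0 <= k <= n ->
  let A m := (polyz (P (2 * (k - 1))%:~R) m).[z] * rho z ^ (k - 1) in
  rho z * (Defs.eta R (k - 1) * ((polyz (P (2 * k)%:~R) (n - k)).[z] * rho z ^ k)) =
    alphaQ alpha a P n k 1 * A (n - 1 - (k - 1)) +
    alphaQ alpha a P n k 3 * A (n - (k - 1)) +
    alphaQ alpha a P n k 5 * A (n + 1 - (k - 1)).
Proof.
move=> alpha1 /andP[z1 z2] hP /andP[k0 kn] A; rewrite /alphaQ.
(* At k = 0 every term carries [eta] at -1, which is 0. *)
have [km1|km1] := ltP (k - 1) 0; first by rewrite /Defs.eta km1 !mul0r !mulr0 !addr0.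
have z2_gt0 : 0 < 1 - z ^+ 2 by nra.
have r0 : rho z != 0 by rewrite gt_eqF// sqrtr_gt0.
have rhoE : rho z ^+ 2 = 1 - z ^+ 2 by rewrite sqr_sqrtr ?ltW.
have bk : (2 * k)%:~R = (2 * (k - 1))%:~R + 2 :> R.
  by rewrite (_ : 2 * k = 2 * (k - 1) + 2) ?intrD//; lia.
have hp := hP _ k0; have hq := hP _ km1; rewrite bk in hp *.
rewrite /A (_ : n - 1 - (k - 1) = n - k); last by lia.
rewrite (_ : n - (k - 1) = n - k + 1); last by lia.
rewrite (_ : n + 1 - (k - 1) = n - k + 2); last by lia.
case: (n - k) (subr_ge0 k n) => [N _|N]; last by rewrite kn.
have := congr1 (horner^~ z) (lower_expansion N alpha1 hp hq).
rewrite /= hornerM !hornerD !hornerZ hornerN hornerXn hornerC -rhoE => E.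
(* The factor split off joins the outer [rho z] to form [rho z ^+ 2], the value of [1 - 'X^2]
   expanded in [E]. *)
have -> : rho z ^ k = rho z ^ (k - 1) * rho z.
  have := @exprzDr _ (rho z) _ (k - 1) 1.
  by rewrite subrK expr1z; apply; rewrite unitfE.
transitivity (Defs.eta R (k - 1) * (rho z ^+ 2 * (P ((2 * (k - 1))%:~R + 2) N).[z])
  * rho z ^ (k - 1)); first by rewrite /polyz; ring.
by rewrite E; ring.
Qed.

(** The outer [rho z] only raises the power to k + 1; the polynomial itself is re-expanded by
    [raise_expansion]. *)
Lemma alphaQ_up (R : realType) (alpha a : R) (P : R -> nat -> {poly R})
    (n k : int) (z : R) :
  -1 < alpha -> alpha < z < 1 ->
  (forall k : int, 0 <= k ->
    orthonormal_polys alpha a (2 * k)%:~R (P (2 * k)%:~R)) ->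
  0 <= k <= n ->
  let A m := (polyz (P (2 * (k + 1))%:~R) m).[z] * rho z ^ (k + 1) in
  rho z * (Defs.eta R k * ((polyz (P (2 * k)%:~R) (n - k)).[z] * rho z ^ k)) =
    alphaQ alpha a P n k 2 * A (n - 1 - (k + 1)) +
    alphaQ alpha a P n k 4 * A (n - (k + 1)) +
    alphaQ alpha a P n k 6 * A (n + 1 - (k + 1)).
Proof.
move=> alpha1 /andP[z1 z2] hP /andP[k0 kn] A; rewrite /alphaQ.
have r0 : rho z != 0 by rewrite gt_eqF// sqrtr_gt0; nra.
have bk : (2 * (k + 1))%:~R = (2 * k)%:~R + 2 :> R.
  by rewrite (_ : 2 * (k + 1) = 2 * k + 2) ?intrD//; lia.
have hp := hP _ k0; have k10 : 0 <= k + 1 by lia.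
have hq := hP _ k10; rewrite bk in hq; rewrite /A bk.
rewrite (_ : n - 1 - (k + 1) = n - k - 2); last by lia.
rewrite (_ : n - (k + 1) = n - k - 1); last by lia.
rewrite (_ : n + 1 - (k + 1) = n - k); last by lia.
case: (n - k) (subr_ge0 k n) => [N _|N]; last by rewrite kn.
have := congr1 (horner^~ z) (raise_expansion N alpha1 hp hq).
rewrite /= !hornerD !hornerZ => E.
rewrite exprzDr ?unitfE// expr1z /= E; ring.
Qed.

Unset Implicit Arguments.
Set Strict Implicit.

Theorem lemma2 (R : realType) (alpha a : R)
    (halpha : -1 < alpha < 1)
    (P : R -> nat -> {poly R})
    (hP : forall k : int, 0 <= k ->
       orthonormal_polys alpha a (2 * k)%:~R (P (2 * k)%:~R))
    (n k i : int) (hnki : admissible n k i)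
    (x y z : R) (hxyz : cap alpha (x, y, z)) :
  [/\ x * Q P n k i x y z =
        alphaQ alpha a P n k 1 * Q P (n - 1) (k - 1) i x y z
      + alphaQ alpha a P n k 2 * Q P (n - 1) (k + 1) i x y z
      + alphaQ alpha a P n k 3 * Q P n (k - 1) i x y z
      + alphaQ alpha a P n k 4 * Q P n (k + 1) i x y z
      + alphaQ alpha a P n k 5 * Q P (n + 1) (k - 1) i x y z
      + alphaQ alpha a P n k 6 * Q P (n + 1) (k + 1) i x y z,
      y * Q P n k i x y z =
        betaQ alpha a P n k i 1 * Q P (n - 1) (k - 1) `|i - 1| x y z
      + betaQ alpha a P n k i 2 * Q P (n - 1) (k + 1) `|i - 1| x y z
      + betaQ alpha a P n k i 3 * Q P n (k - 1) `|i - 1| x y z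
      + betaQ alpha a P n k i 4 * Q P n (k + 1) `|i - 1| x y z
      + betaQ alpha a P n k i 5 * Q P (n + 1) (k - 1) `|i - 1| x y z
      + betaQ alpha a P n k i 6 * Q P (n + 1) (k + 1) `|i - 1| x y z
    & z * Q P n k i x y z =
        gammaQ P n k 1 * Q P (n - 1) k i x y z
      + gammaQ P n k 2 * Q P n k i x y z
      + gammaQ P n k 3 * Q P (n + 1) k i x y z ].
Proof.
have /andP[alpha1 _] := halpha; have [z12 _] := hxyz.
move: (hnki) => /andP[kn ki]; have /andP[k0 kn_le] := kn.
have [xE yE] := theta_polar alpha1 hxyz.
have := alphaQ_down alpha1 z12 hP kn.
have := alphaQ_up alpha1 z12 hP kn.
rewrite /= !QE; set t := theta x y z in xE yE *.
set F := (polyz _ (n - k)).[z] * rho z ^ k => up down.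
split.
(* The six terms are grouped by frequency: odd j belong to k - 1 and even j to k + 1. *)
- transitivity (rho z * (Defs.eta R (k - 1) * F) * Yext (k - 1) i t +
    rho z * (Defs.eta R k * F) * Yext (k + 1) i t); last by rewrite up down; ring.
  by rewrite {1}xE -mulrA [cos t * _]mulrCA cosM_Yext//; ring.
- case/orP: ki => [/eqP ->|/andP[/eqP-> k1]].
    transitivity (rho z * (Defs.eta R k * F) * Yext (k + 1) 1 t -
      rho z * (Defs.eta R (k - 1) * F) * Yext (k - 1) 1 t).
      by rewrite {1}yE -mulrA [sin t * _]mulrCA sinM_Yext0//; ring.
    by rewrite up down /betaQ /= sub0r normrN1; ring.
  transitivity (rho z * (Defs.eta R (k - 1) * F) * Yext (k - 1) 0 t -
    rho z * (Defs.eta R k * F) * Yext (k + 1) 0 t).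
    by rewrite {1}yE -mulrA [sin t * _]mulrCA sinM_Yext1//; ring.
  by rewrite up down /betaQ /= subrr normr0; ring.
(* Multiplication by [z] leaves the angular factor and the power of [rho z] alone, so this is the
   univariate recurrence at index n - k. *)
- have [_ /(_ (n - k))] := rec_coefsP alpha1 (hP k k0).
  rewrite subr_ge0 => /(_ kn_le) /(congr1 (horner^~ z)).
  rewrite hornerM hornerX !hornerD !hornerZ => zE.
  rewrite (_ : n - 1 - k = n - k - 1); last by lia.
  rewrite (_ : n + 1 - k = n - k + 1); last by lia.
  rewrite /F /gammaQ /alphaR /betaR !mulrA zE; ring.
Qed.
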